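(* Let $(R,m_R)$ be a Noetherian local ring of dimension $d$ and let $I_1,\dots,I_r$ be ideals of $R$. Then there exists a numerical polynomial $F\in\mathbb{Q}[n_1,\dots,n_r]$ of total degree at most $d$ such that $$l_R\left(H^0_{m_R}\left(\frac{R}{I_1^{n_1}\cdots I_r^{n_r}}\right)\right)\le F(n_1,\dots,n_r)$$ for all $n_1,\dots,n_r\gg0$.
   Context: $H^0_{m_R}(N)$ is the submodule of elements of $N$ annihilated by some power of $m_R$; $l_R$ denotes length. A numerical polynomial is a polynomial with rational coefficients taking integer values at integer points. *)

(* Defs.v *)
From HB Require Import structures.
From mathcomp Require Import all_boot all_order all_algebra.
From mathcomp Require Export mpoly.
Set Implicit Arguments. Unset Strict Implicit. Unset Printing Implicit Defensive.
Import Order.TTheory GRing.Theory Num.Theory.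
Local Open Scope ring_scope.

Section CommAlg.
Variable R : comNzRingType.

Definition subsetR (I J : R -> Prop) := forall x, I x -> J x.
Definition ssubsetR (I J : R -> Prop) := subsetR I J /\ exists x, J x /\ ~ I x.

Definition is_ideal (I : R -> Prop) :=
  [/\ I 0, (forall x y, I x -> I y -> I (x + y)) & (forall a x, I x -> I (a * x))].

Definition proper_ideal (I : R -> Prop) := is_ideal I /\ ~ I 1.

Definition prime_ideal (P : R -> Prop) :=
  proper_ideal P /\ (forall x y, P (x * y) -> P x \/ P y).

Definition local_ring_with (m : R -> Prop) :=
  proper_ideal m /\ (forall J, proper_ideal J -> subsetR J m).

Definition noetherian :=
  forall I : nat -> R -> Prop, (forall k, is_ideal (I k)) ->
    (forall k, subsetR (I k) (I k.+1)) ->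
    exists N, forall k, (N <= k)%N -> subsetR (I k) (I N).

Definition prime_chain (k : nat) (P : 'I_k.+1 -> R -> Prop) :=
  (forall i, prime_ideal (P i)) /\
  (forall i : 'I_k, ssubsetR (P (widen_ord (leqnSn k) i)) (P (lift ord0 i))).

Definition krull_dim (d : nat) :=
  (exists P, prime_chain (k := d) P) /\
  (forall k P, prime_chain (k := k) P -> (k <= d)%N).

Definition ideal_mul (I J : R -> Prop) : R -> Prop := fun x =>
  exists (n : nat) (a b : 'I_n -> R),
    [/\ forall i, I (a i), forall i, J (b i) & x = \sum_(i < n) a i * b i].

Definition unit_ideal : R -> Prop := fun _ => True.

Fixpoint ideal_pow (I : R -> Prop) (n : nat) : R -> Prop :=
  if n is n'.+1 then ideal_mul (ideal_pow I n') I else unit_ideal.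

Definition ideal_prod_pow (r : nat) (I : 'I_r -> R -> Prop) (n : 'I_r -> nat)
  : R -> Prop :=
  \big[ideal_mul/unit_ideal]_(i < r) ideal_pow (I i) (n i).

(* Saturation J : m^oo; the ideal whose image in R/J is H^0_m(R/J). *)
Definition saturation (J m : R -> Prop) : R -> Prop := fun x =>
  exists k, forall y, ideal_pow m k y -> J (y * x).

(* Strict chain of ideals K_0 < ... < K_l with J <= K_0 and K_l <= K.
   Such chains are exactly chains of submodules of the R-module K/J. *)
Definition ideal_chain_between (J K : R -> Prop) (l : nat)
  (C : 'I_l.+1 -> R -> Prop) :=
  [/\ forall i, is_ideal (C i), subsetR J (C ord0), subsetR (C ord_max) K &
      forall i : 'I_l, ssubsetR (C (widen_ord (leqnSn l) i)) (C (lift ord0 i))].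

(* l_R(K/J) <= b (length = supremum of lengths of chains of submodules;
   this in particular forces the length to be finite). *)
Definition length_quot_le (J K : R -> Prop) (b : rat) :=
  forall l C, ideal_chain_between J K (l := l) C -> (l%:R <= b)%R.

Definition length_H0_le (m J : R -> Prop) (b : rat) :=
  length_quot_le J (saturation J m) b.

End CommAlg.

Definition numerical_poly (r : nat) (F : {mpoly rat[r]}) :=
  forall z : 'I_r -> int, exists k : int, F.@[fun i => (z i)%:~R] = k%:~R.

(* Main.v *)
Require Import Defs.
From mathcomp Require Import all_boot all_order all_algebra.
From mathcomp Require Import mpoly ring.
From Stdlib Require Import Classical ClassicalEpsilon.
Set Implicit Arguments. Unset Strict Implicit. Unset Printing Implicit Defensive.
Import GRing.Theory Num.Theory.
Local Open Scope ring_scope.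

(** Write [J_n] for the product of the powers [I_i^(n_i)] and [|n|] for the sum of the [n_i].
    The graded pieces [m^k J_n] form a multigraded Rees algebra, which is Noetherian by
    Hilbert's basis theorem; the ascending chain condition for its graded submodules gives
    one constant [c] with
      [m^k J_n /\ (J_(n + e_i) : m^oo) <= m^(k - c) J_(n + e_i)]  for all [n], [i], [k >= c].
    By induction on [|n|], [m^(c |n|)] meets [J_n : m^oo] inside [J_n], so that
    [H^0_m(R / J_n)] embeds in [R / m^(c |n|)], whose length is [O(|n|^d)]. *)

(** * Chain conditions *)

(** The obstacle is uniformity: for each [n] some power of [m] multiplies [J_n : m^oo] into [J_n],
    but nothing bounds its exponent a priori as [n] varies. The index of an ascending chain absorbs
    it: an element that [m^t] carries into [J_(n + e_i)] enters the chain at a stage depending on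
    [t], and the stage where the chain stops, common to all degrees, is [c]. Linearity of [c |n|]
    keeps the degree at [d]: a bound [l N^d] for the colength of [m^N], taken at [N = c |n|], gives
    [F = l c^d (X_1 + ... + X_r)^d]. Only an upper bound is wanted, so no Hilbert polynomial is
    built. *)

Definition acc (T : Type) (C : (T -> Prop) -> Prop) :=
  forall K : nat -> T -> Prop, (forall k, C (K k)) ->
    (forall k x, K k x -> K k.+1 x) ->
    exists N, forall k, (N <= k)%N -> forall x, K k x -> K N x.

Lemma chain_mono (T : Type) (K : nat -> T -> Prop) :
  (forall k x, K k x -> K k.+1 x) ->
  forall i j, (i <= j)%N -> forall x, K i x -> K j x.
Proof.
move=> up i j /subnK <-; elim: (j - i)%N => [|n IH] x //.
by move/IH/up.
Qed.

Lemma acc_maximal (T : Type) (C P : (T -> Prop) -> Prop) (M0 : T -> Prop) :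
  acc C -> (forall M, P M -> C M) -> P M0 ->
  exists2 M, P M & forall M', P M' -> (forall x, M x -> M' x) ->
    forall x, M' x -> M x.
Proof.
move=> accC PC PM0; apply: NNPP => noM.
have grow (M : {M | P M}) : exists M' : {M | P M},
    (forall x, sval M x -> sval M' x) /\ exists2 x, sval M' x & ~ sval M x.
  case: M => M PM /=; apply: NNPP => noM'; apply: noM.
  exists M => // M' PM' sMM' x M'x; apply: NNPP => nMx; apply: noM'.
  by exists (exist _ M' PM'); split => //; exists x.
pose nxt M := sval (constructive_indefinite_description _ (grow M)).
have nxtP M : (forall x, sval M x -> sval (nxt M) x) /\
    exists2 x, sval (nxt M) x & ~ sval M x.
  by rewrite /nxt; case: constructive_indefinite_description.
pose K k := iter k nxt (exist _ M0 PM0).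
have [] := accC (fun k => sval (K k)).
- by move=> k; apply: PC; case: (K k).
- by move=> k; have [] := nxtP (K k).
move=> N /(_ N.+1 (leqnSn N)) stN; have [_ [x Kx nKx]] := nxtP (K N).
exact/nKx/stN.
Qed.

(** * Hilbert's basis theorem for subrings *)

Section HilbertBasis.
Variable B : comNzRingType.
Implicit Types (S K : B -> Prop) (a b x y z : B).

Definition subring S :=
  [/\ S 1, S (-1), forall x y, S x -> S y -> S (x + y) &
      forall x y, S x -> S y -> S (x * y)].

Definition ideal_of S K :=
  [/\ forall x, K x -> S x, K 0, forall x y, K x -> K y -> K (x + y) &
      forall a x, S a -> K x -> K (a * x)].

(** Values at [b] of polynomials of degree below [i] over [S]. As [b] may be algebraic over [S], an
    element has many such expressions and no degree of its own. *)
Fixpoint poly_below S b i y :=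
  if i is j.+1 then exists c z, [/\ S c, poly_below S b j z & y = z + c * b ^+ j]
  else y = 0.

Definition adjoin S b y := exists i, poly_below S b i y.

Lemma subring0 S : subring S -> S 0.
Proof. by case=> S1 SN1 SD _; rewrite -(subrr 1); apply: SD. Qed.

Section Adjoin.
Variables (S : B -> Prop) (b : B).
Hypothesis ringS : subring S.

Let S0 : S 0. Proof. exact: subring0. Qed.
Let S1 : S 1. Proof. by case: ringS. Qed.
Let SN1 : S (-1). Proof. by case: ringS. Qed.
Let SD x y : S x -> S y -> S (x + y). Proof. by case: ringS => _ _ + _; apply. Qed.
Let SM x y : S x -> S y -> S (x * y). Proof. by case: ringS => _ _ _; apply. Qed.

Lemma poly_below0 i : poly_below S b i 0.
Proof. by elim: i => //= i IH; exists 0, 0; rewrite mul0r addr0. Qed.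

Lemma poly_belowS i y : poly_below S b i y -> poly_below S b i.+1 y.
Proof. by move=> iy; exists 0, y; rewrite mul0r addr0. Qed.

Lemma poly_below_le i j y : (i <= j)%N -> poly_below S b i y -> poly_below S b j y.
Proof. by move=> le_ij; apply: (chain_mono poly_belowS). Qed.

Lemma poly_belowD i x y :
  poly_below S b i x -> poly_below S b i y -> poly_below S b i (x + y).
Proof.
elim: i x y => /= [|i IH] x y; first by move=> -> ->; rewrite addr0.
move=> [c [z [Sc iz ->]]] [c' [z' [Sc' iz' ->]]].
exists (c + c'), (z + z'); split; [exact: SD | exact: IH |].
by rewrite mulrDl addrACA.
Qed.

Lemma poly_belowZ i a x :
  S a -> poly_below S b i x -> poly_below S b i (a * x).
Proof.
move=> Sa; elim: i x => /= [|i IH] x; first by move=> ->; rewrite mulr0.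
move=> [c [z [Sc iz ->]]].
exists (a * c), (a * z); split; [exact: SM | exact: IH |].
by rewrite mulrDr mulrA.
Qed.

Lemma poly_belowX i x : poly_below S b i x -> poly_below S b i.+1 (b * x).
Proof.
elim: i x => [|i IH] x; first by move=> ->; rewrite mulr0; apply: poly_below0.
case=> c [z [Sc iz ->]]; exists c, (b * z); split => //; first exact: IH.
by rewrite mulrDr mulrCA -exprS.
Qed.

Lemma poly_belowXn i j x : poly_below S b i x -> poly_below S b (j + i) (b ^+ j * x).
Proof.
move=> ix; elim: j => [|j IH]; first by rewrite mul1r.
by rewrite exprS -mulrA; apply: poly_belowX.
Qed.

Lemma poly_belowM i j x y :
  poly_below S b i x -> poly_below S b j y -> poly_below S b (i + j) (x * y).
Proof.
move=> + jy; elim: i x => [|i IH] x.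
  by move=> ->; rewrite mul0r; apply: poly_below0.
case=> c [z [Sc iz ->]]; rewrite mulrDl -mulrA; apply: poly_belowD.
  by apply: poly_belowS; apply: IH.
apply: poly_belowZ => //; apply: poly_below_le (poly_belowXn i jy).
by rewrite leq_add2r.
Qed.

Lemma adjoin_sub x : S x -> adjoin S b x.
Proof. by exists 1%N, x, 0; rewrite mulr1 add0r. Qed.

Lemma adjoin_gen : adjoin S b b.
Proof. by exists 2%N, 1, 0; rewrite mul1r add0r; split => //; apply: poly_below0. Qed.

Lemma adjoin_subring : subring (adjoin S b).
Proof.
split; [exact: adjoin_sub | exact: adjoin_sub | |].
- move=> x y [i ix] [j jy]; exists (maxn i j); apply: poly_belowD.
    exact: poly_below_le (leq_maxl i j) ix.
  exact: poly_below_le (leq_maxr i j) jy.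
- by move=> x y [i ix] [j jy]; exists (i + j)%N; apply: poly_belowM.
Qed.

Lemma adjoin_min G : subring G -> (forall x, S x -> G x) -> G b ->
  forall x, adjoin S b x -> G x.
Proof.
move=> ringG SG Gb x [i]; case: (ringG) => G1 _ GD GM.
have GX j : G (b ^+ j) by elim: j => // j IH; rewrite exprS; apply: GM.
elim: i x => [|i IH] x /=; first by move=> ->; apply: subring0.
by case=> c [z [/SG Gc /IH Gz ->]]; apply: GD => //; apply: GM.
Qed.

(* Ideals of leading coefficients: a chain [K] of ideals of [S[b]] is constant
   as soon as, for every degree [i], the chain [lead K _ i] is. *)
Definition lead (K : nat -> B -> Prop) n i c :=
  S c /\ exists2 y, poly_below S b i y & K n (y + c * b ^+ i).

Lemma adjoin_acc : acc (ideal_of S) -> acc (ideal_of (adjoin S b)).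
Proof.
move=> accS K idK upK.
have KD n x y : K n x -> K n y -> K n (x + y) by case: (idK n) => _ _ + _; apply.
have KM n a x : adjoin S b a -> K n x -> K n (a * x).
  by case: (idK n) => _ _ _; apply.
have idL n i : ideal_of S (lead K n i).
  split=> [c [] //||c c' [Sc [y iy Ky]] [Sc' [y' iy' Ky']]|a c Sa [Sc [y iy Ky]]].
  - split=> //; exists 0; first exact: poly_below0.
    by rewrite mul0r addr0; case: (idK n).
  - split; first exact: SD.
    exists (y + y'); first exact: poly_belowD.
    by rewrite mulrDl addrACA; apply: KD.
  - split; first exact: SM.
    exists (a * y); first exact: poly_belowZ.
    by rewrite -mulrA -mulrDr; apply: KM => //; apply: adjoin_sub.
have upLn i n c : lead K n i c -> lead K n.+1 i c.
  by case=> Sc [y iy Ky]; split=> //; exists y => //; apply: upK.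
have upLi n i c : lead K n i c -> lead K n i.+1 c.
  case=> Sc [y iy Ky]; split=> //; exists (b * y); first exact: poly_belowX.
  by rewrite exprS mulrCA -mulrDr; apply: KM => //; apply: adjoin_gen.
(* [lead] grows in both indices, so its diagonal is a chain too; where it stops, it controls all
   degrees from [N] on. Finitely many degrees remain for [M]. *)
have [N stN] : exists N, forall n, (N <= n)%N -> forall c, lead K n n c -> lead K N N c.
  by apply: (accS (fun n => lead K n n)) => // n c /upLn/upLi.
have [M stM] : exists M, forall i, (i < N)%N -> forall n, (M <= n)%N ->
    forall c, lead K n i c -> lead K M i c.
  elim: (N) => [|k [M IH]]; first by exists 0%N.
  have [M' stM'] := accS (fun n => lead K n k) (fun n => idL n k) (upLn k).
  exists (maxn M M') => i; rewrite ltnS leq_eqVlt => /orP[/eqP-> | lt_ik] n;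
    rewrite geq_max => /andP[Mn M'n] c /=.
    move/(stM' n M'n); exact: (chain_mono (upLn k) (leq_maxr _ _)).
  move/(IH i lt_ik n Mn); exact: (chain_mono (upLn i) (leq_maxl _ _)).
exists (maxn N M) => n; rewrite geq_max => /andP[Nn Mn] x Kx.
have stL i c : lead K n i c -> lead K (maxn N M) i c.
  case: (ltnP i N) => [lt_iN | le_Ni].
    by move/(stM i lt_iN n Mn); apply: (chain_mono (upLn i) (leq_maxr _ _)).
  (* Climb to the diagonal at [maxn n i], drop to [(N, N)] by stability, climb back to degree [i]
     and stage [maxn N M]. *)
  move=> Lc; have : lead K (maxn n i) (maxn n i) c.
    apply: (chain_mono (upLn _) (leq_maxl n i)).
    exact: (chain_mono (upLi n) (leq_maxr n i)).
  move/(stN _ (leq_trans Nn (leq_maxl _ _))).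
  move/(chain_mono (upLi N) le_Ni).
  exact: (chain_mono (upLn i) (leq_maxl N M)).
have [i] : adjoin S b x by case: (idK n) => + _ _ _; apply.
elim: i x Kx => [|i IH] x Kx /=; first by move=> ->; case: (idK (maxn N M)).
case=> c [z [Sc iz xE]].
have [_ [y iy Ky]] : lead K (maxn N M) i c.
  by apply: stL; split=> //; exists z => //; rewrite -xE.
(* The first summand lies in the stable stage and shares the leading term of [x]; the difference has
   lower degree and still lies in [K n]. *)
have -> : x = (y + c * b ^+ i) + (z - y) by rewrite xE; ring.
apply: (KD) => //; apply: IH; last first.
  by apply: poly_belowD => //; rewrite -mulN1r; apply: poly_belowZ.
have -> : z - y = x + -1 * (y + c * b ^+ i).
  by rewrite xE mulN1r opprD addrACA subrr addr0.
apply: KD => //; apply: KM; first exact: adjoin_sub.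
by apply: (chain_mono upK) Ky; rewrite geq_max Nn Mn.
Qed.

End Adjoin.

Lemma adjoin_seq S G (s : seq B) :
  subring S -> acc (ideal_of S) -> subring G -> (forall x, S x -> G x) ->
  (forall x, x \in s -> G x) ->
  exists S', [/\ subring S', acc (ideal_of S'), forall x, S x -> S' x,
    forall x, S' x -> G x & forall x, x \in s -> S' x].
Proof.
elim: s S => [|b s IH] S ringS accS ringG SG sG; first by exists S.
have Gb : G b by apply: sG; rewrite mem_head.
have [|x xs|S' [ringS' accS' SS' S'G sS']] :=
  IH _ (@adjoin_subring S b ringS) (@adjoin_acc S b ringS accS) ringG.
- exact: adjoin_min.
- by apply: sG; rewrite inE xs orbT.
exists S'; split=> // x; first by move=> Sx; apply/SS'/adjoin_sub.
by rewrite inE => /orP[/eqP-> | /sS' //]; apply/SS'/adjoin_gen.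
Qed.

End HilbertBasis.

(** * Ideals *)

Section Ideals.
Variable R : comNzRingType.
Implicit Types (I J K L P Q m : R -> Prop) (a b x y z : R).

Lemma ideal0 I : is_ideal I -> I 0. Proof. by case. Qed.

Lemma idealD I x y : is_ideal I -> I x -> I y -> I (x + y).
Proof. by case=> _ + _; apply. Qed.

Lemma idealMl I a x : is_ideal I -> I x -> I (a * x).
Proof. by case=> _ _; apply. Qed.

Lemma idealMr I a x : is_ideal I -> I x -> I (x * a).
Proof. by rewrite mulrC; apply: idealMl. Qed.

Lemma idealB I x y : is_ideal I -> I x -> I y -> I (x - y).
Proof. by move=> idI Ix Iy; rewrite -mulN1r; apply: idealD => //; apply: idealMl. Qed.

Lemma ideal1 I : is_ideal I -> I 1 -> forall x, I x.
Proof. by move=> idI I1 x; rewrite -[x]mulr1; apply: idealMl. Qed.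

Lemma ideal_mul_in I J a b : I a -> J b -> ideal_mul I J (a * b).
Proof. by move=> Ia Jb; exists 1%N, (fun=> a), (fun=> b); rewrite big_ord1. Qed.

Lemma ideal_mul_min I J K : K 0 -> (forall x y, K x -> K y -> K (x + y)) ->
  (forall a b, I a -> J b -> K (a * b)) -> subsetR (ideal_mul I J) K.
Proof.
move=> K0 KD KIJ x [n [a [b [Ia Jb ->]]]].
by apply: big_ind => // i _; apply: KIJ.
Qed.

Lemma ideal_mulD I J x y :
  ideal_mul I J x -> ideal_mul I J y -> ideal_mul I J (x + y).
Proof.
move=> [n [a [b [Ia Jb ->]]]] [n' [a' [b' [Ia' Jb' ->]]]].
exists (n + n')%N, (fun i => match split i with inl j => a j | inr j => a' j end),
  (fun i => match split i with inl j => b j | inr j => b' j end).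
split=> [i|i|]; try by case: split.
rewrite big_split_ord /=; congr (_ + _); apply: eq_bigr => i _.
  by rewrite (unsplitK (inl i)).
by rewrite (unsplitK (inr i)).
Qed.

Lemma ideal_mul0 I J : ideal_mul I J 0.
Proof. by exists 0%N, (fun=> 0), (fun=> 0); rewrite big_ord0; split=> // -[]. Qed.

Lemma ideal_mul_ideal I J : is_ideal I -> is_ideal (ideal_mul I J).
Proof.
move=> idI; split; [exact: ideal_mul0 | exact: ideal_mulD |].
move=> c x [n [a [b [Ia Jb ->]]]]; exists n, (fun i => c * a i), b.
split=> // [i|]; first exact: idealMl.
by rewrite mulr_sumr; apply: eq_bigr => i _; rewrite mulrA.
Qed.

Lemma ideal_mul_mono I J I' J' : subsetR I I' -> subsetR J J' ->
  subsetR (ideal_mul I J) (ideal_mul I' J').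
Proof.
move=> sI sJ; apply: ideal_mul_min => [|x y|a b /sI Ia /sJ Jb].
- exact: ideal_mul0.
- exact: ideal_mulD.
- exact: ideal_mul_in.
Qed.

Lemma ideal_mulM I J I1 J1 I2 J2 :
  (forall x y, I x -> I1 y -> I2 (x * y)) ->
  (forall x y, J x -> J1 y -> J2 (x * y)) ->
  forall x y, ideal_mul I J x -> ideal_mul I1 J1 y -> ideal_mul I2 J2 (x * y).
Proof.
move=> MI MJ x y IJx; move: y.
apply: ideal_mul_min => [|y z|a b I1a J1b].
- by rewrite mulr0; apply: ideal_mul0.
- by rewrite mulrDr; apply: ideal_mulD.
move: x IJx; apply: ideal_mul_min => [|y z|a' b' Ia' Jb'].
- by rewrite mul0r; apply: ideal_mul0.
- by rewrite mulrDl; apply: ideal_mulD.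
by rewrite mulrACA; apply: ideal_mul_in; [apply: MI | apply: MJ].
Qed.

Lemma ideal_pow_ideal I n : is_ideal I -> is_ideal (ideal_pow I n).
Proof. by move=> idI; elim: n => //= n IH; apply: ideal_mul_ideal. Qed.

Lemma ideal_powM I i j x y : is_ideal I ->
  ideal_pow I i x -> ideal_pow I j y -> ideal_pow I (i + j) (x * y).
Proof.
move=> idI Ix; elim: j y => [|j IH] y.
  by rewrite addn0 => _; apply: idealMr => //; apply: ideal_pow_ideal.
rewrite addnS; move: y; apply: ideal_mul_min => [|y z|a b Ia Ib].
- by rewrite mulr0; apply: ideal_mul0.
- by rewrite mulrDr; apply: ideal_mulD.
by rewrite mulrA; apply: ideal_mul_in => //; apply: IH.
Qed.

Lemma ideal_powS I n : is_ideal I -> subsetR (ideal_pow I n.+1) (ideal_pow I n).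
Proof.
move=> idI; have idIn := ideal_pow_ideal n idI.
apply: ideal_mul_min => [|x y|a b Ia _]; first exact: ideal0.
- exact: idealD.
- exact: idealMr.
Qed.

Lemma ideal_pow_le I i j : is_ideal I -> (i <= j)%N ->
  subsetR (ideal_pow I j) (ideal_pow I i).
Proof.
move=> idI /subnK <-; elim: (j - i)%N => [|n IH] x //.
by move/(ideal_powS idI)/IH.
Qed.

Lemma ideal_powX I n x : I x -> ideal_pow I n (x ^+ n).
Proof.
by move=> Ix; elim: n => // n IH; rewrite exprSr; apply: ideal_mul_in.
Qed.

Section ProdPow.
Variables (r : nat) (I : 'I_r -> R -> Prop).
Hypothesis idI : forall i, is_ideal (I i).

Lemma ideal_prod_pow_ideal n : is_ideal (ideal_prod_pow I n).
Proof.
apply: big_ind => // [K K' idK _|i _]; first exact: ideal_mul_ideal.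
exact: ideal_pow_ideal.
Qed.

Lemma eq_ideal_prod_pow n n' : n =1 n' -> ideal_prod_pow I n = ideal_prod_pow I n'.
Proof. by move=> E; apply: eq_bigr => i _; rewrite E. Qed.

Lemma ideal_prod_powM (n n' : 'X_{1..r}) x y :
  ideal_prod_pow I n x -> ideal_prod_pow I n' y ->
  ideal_prod_pow I (n + n')%MM (x * y).
Proof.
move: x y; rewrite /ideal_prod_pow.
apply: (big_ind3 (fun K K' K'' : R -> Prop =>
  forall x y, K x -> K' y -> K'' (x * y))) => //.
- by move=> K1 K2 K3 L1 L2 L3; apply: ideal_mulM.
- by move=> i _ x y; rewrite mnmDE; apply: ideal_powM.
Qed.

Lemma ideal_prod_pow_gen i y : I i y -> ideal_prod_pow I U_(i)%MM y.
Proof.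
move=> Iy; have -> : y = \prod_(j < r) if j == i then y else 1.
  by rewrite -big_mkcond big_pred1_eq.
apply: (big_ind2 (fun (K : R -> Prop) z => K z)) => // [K z K' z'|j _].
  exact: ideal_mul_in.
rewrite mnm1E eq_sym; case: eqP => [->|_] //=.
by rewrite -[y]mul1r; apply: ideal_mul_in.
Qed.

Lemma ideal_prod_pow0 n : (forall i, n i = 0%N) -> ideal_prod_pow I n 1.
Proof.
move=> n0; apply: (big_ind (fun K : R -> Prop => K 1)) => // [K K'|i _].
  by move=> *; rewrite -[1]mul1r; apply: ideal_mul_in.
by rewrite n0.
Qed.

Lemma ideal_prod_powDr (n n' : 'X_{1..r}) :
  subsetR (ideal_prod_pow I (n + n')%MM) (ideal_prod_pow I n).
Proof.
apply: (big_ind2 (@subsetR R)) => // [K1 K2 L1 L2|i _].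
  exact: ideal_mul_mono.
by rewrite mnmDE; apply: ideal_pow_le => //; apply: leq_addr.
Qed.

End ProdPow.

(** An ideal maximal among those generated by finitely many elements of [I] contains each element of
    [I], since adjoining that element cannot enlarge it. *)
Lemma noetherian_fg I : noetherian R -> is_ideal I ->
  exists s : seq R, (forall f, f \in s -> I f) /\
    forall K, is_ideal K -> (forall f, f \in s -> K f) -> subsetR I K.
Proof.
move=> noeR idI.
pose gen (s : seq R) x := forall K, is_ideal K -> (forall f, f \in s -> K f) -> K x.
have gen_ideal s : is_ideal (gen s).
  split=> [K idK _|x y gx gy K idK sK|a x gx K idK sK]; first exact: ideal0.
  - by apply: idealD => //; [apply: gx | apply: gy].
  - by apply: idealMl => //; apply: gx.
have [||M [s [sI ->]] maxM] := @acc_maximal R (@is_ideal R)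
  (fun M => exists s, (forall f, f \in s -> I f) /\ M = gen s) (gen [::]) noeR.
- by move=> _ [s [_ ->]].
- by exists [::].
exists s; split=> // K idK sK x Ix; suff: gen s x by apply.
apply: (maxM (gen (x :: s))).
- exists (x :: s); split=> // f; rewrite inE => /orP[/eqP-> //|]; exact: sI.
- move=> y gy L idL sL; apply: gy => // f fs; apply: sL.
  by rewrite inE fs orbT.
- by move=> L _; apply; rewrite mem_head.
Qed.

Definition colon L x : R -> Prop := fun z => L (x * z).

Definition ideal_add I J : R -> Prop := fun z => exists x y, [/\ I x, J y & z = x + y].

Definition principal x : R -> Prop := fun z => exists a, z = a * x.

Lemma colon_ideal L x : is_ideal L -> is_ideal (colon L x).
Proof.
move=> idL; rewrite /colon; split=> [|y z Ly Lz|a y Ly].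
- by rewrite mulr0; apply: ideal0.
- by rewrite mulrDr; apply: idealD.
- by rewrite mulrCA; apply: idealMl.
Qed.

Lemma principal_ideal x : is_ideal (principal x).
Proof.
split=> [|_ _ [a ->] [b ->]|a _ [b ->]].
- by exists 0; rewrite mul0r.
- by exists (a + b); rewrite mulrDl.
- by exists (a * b); rewrite mulrA.
Qed.

Lemma ideal_add_ideal I J : is_ideal I -> is_ideal J -> is_ideal (ideal_add I J).
Proof.
move=> idI idJ; split=> [|_ _ [x [y [Ix Jy ->]]] [x' [y' [Ix' Jy' ->]]]|
  a _ [x [y [Ix Jy ->]]]].
- by exists 0, 0; rewrite addr0; split=> //; apply: ideal0.
- by exists (x + x'), (y + y'); rewrite addrACA; split=> //; apply: idealD.
- by exists (a * x), (a * y); rewrite mulrDr; split=> //; apply: idealMl.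
Qed.

Lemma ideal_addl I J : is_ideal J -> subsetR I (ideal_add I J).
Proof. by move=> idJ x Ix; exists x, 0; rewrite addr0; split=> //; apply: ideal0. Qed.

Lemma ideal_addr I J : is_ideal I -> subsetR J (ideal_add I J).
Proof. by move=> idI x Ix; exists 0, x; rewrite add0r; split=> //; apply: ideal0. Qed.

Lemma principal_gen x : principal x x. Proof. by exists 1; rewrite mul1r. Qed.

Lemma not_subset I J : ~ subsetR I J -> exists2 x, I x & ~ J x.
Proof.
move=> nIJ; apply: NNPP => no; apply: nIJ => x Ix.
by apply: NNPP => nJx; apply: no; exists x.
Qed.

(** * Colength *)

(* The length of [R/L] is at most [n], by recursion on the first step of a
   strict chain of ideals above [L]. *)
Fixpoint colength_le n L : Prop :=
  forall L', is_ideal L' -> ssubsetR L L' ->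
    if n is k.+1 then colength_le k L' else False.

Lemma colength_le_mono n L L' : subsetR L L' -> colength_le n L -> colength_le n L'.
Proof.
move=> sLL'; case: n => [|n] cL K idK [sK [x [Kx nx]]]; apply: (cL K) => //;
  by split=> [y /sLL'/sK //|]; exists x; split=> // /sLL'.
Qed.

Lemma ideal_add_mono I I' J : subsetR I I' -> subsetR (ideal_add I J) (ideal_add I' J).
Proof. by move=> sI _ [u [v [/sI Iu Jv ->]]]; exists u, v. Qed.

Lemma colon_mono L L' x : subsetR L L' -> subsetR (colon L x) (colon L' x).
Proof. by move=> sL w /sL. Qed.

(** If neither inclusion is strict, any [z] in [L'] is [w + c x] with [w] in [L]; then [c] lies in
    [L' : x = L : x], so [z] lies in [L]. *)
Lemma ssubset_colon_or_add L L' x : is_ideal L -> is_ideal L' -> ssubsetR L L' ->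
  ssubsetR (colon L x) (colon L' x) \/
  ssubsetR (ideal_add L (principal x)) (ideal_add L' (principal x)).
Proof.
move=> idL idL' [sL [z [L'z nLz]]].
apply: NNPP => /not_or_and [nC nA]; apply: nLz.
have [w [_ [Lw [c ->] zE]]] : ideal_add L (principal x) z.
  apply: NNPP => nz; apply: nA; split; first exact: ideal_add_mono.
  by exists z; split=> //; apply: ideal_addl => //; apply: principal_ideal.
rewrite zE; apply: idealD => //; rewrite mulrC.
apply: NNPP => nc; apply: nC; split; first exact: colon_mono.
exists c; split=> //; rewrite /colon (_ : x * c = z - w); last by rewrite zE; ring.
by apply: idealB => //; apply: sL.
Qed.

(* Length is additive on [0 -> R/(L : x) -> R/L -> R/(L + x) -> 0]. *)
Lemma colength_le_colon L x (a b : nat) : is_ideal L -> colength_le a (colon L x) ->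
  colength_le b (ideal_add L (principal x)) -> colength_le (a + b) L.
Proof.
(* Induction on the sum: a strict step above [L] is strict in the colon or in the sum with [x], and
   uses up one unit of [a] or of [b]. *)
move: {2}(a + b)%N (erefl (a + b)%N) => n.
elim: n L a b => [|n IH] L a b abE idL ca cb.
  move/eqP: abE; rewrite addn_eq0 => /andP[/eqP a0 /eqP b0].
  rewrite a0 b0 in ca cb *; move=> L' idL' sL.
  case: (ssubset_colon_or_add x idL idL' sL) => [/(ca _ (colon_ideal x idL')) //|].
  by move/(cb _ (ideal_add_ideal idL' (principal_ideal x))).
rewrite abE => L' idL' sL /=.
case: (ssubset_colon_or_add x idL idL' sL) => sX.
- case: a abE ca => [|a] abE ca; first by case: (ca _ (colon_ideal x idL') sX).
  move: abE; rewrite addSn => -[abE]; rewrite -abE; apply: IH => //.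
    exact: (ca _ (colon_ideal x idL') sX).
  by apply: colength_le_mono cb; apply: ideal_add_mono; case: sL.
- have idA := ideal_add_ideal idL' (principal_ideal x).
  case: b abE cb => [|b] abE cb; first by case: (cb _ idA sX).
  move: abE; rewrite addnS => -[abE]; rewrite -abE; apply: IH => //.
    by apply: colength_le_mono ca; apply: colon_mono; case: sL.
  exact: (cb _ idA sX).
Qed.

(** [L : x] contains [x^(N-1)], and adding [x] to it gives an ideal above [L + (x)], so each of the
    [N] layers has length at most [a]. *)
Lemma colength_le_expr L x N (a : nat) : is_ideal L -> L (x ^+ N) ->
  colength_le a (ideal_add L (principal x)) -> colength_le (N * a) L.
Proof.
elim: N L => [|N IH] L idL LxN cA.
  by move=> L' idL' [_ [z [_]]]; case; apply: ideal1.
rewrite mulSn addnC; apply: colength_le_colon (cA) => //; apply: IH.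
- exact: colon_ideal.
- by rewrite /colon -exprS.
- apply: colength_le_mono cA; apply: ideal_add_mono => u Lu.
  exact: idealMl.
Qed.

Lemma colength_le_chain n l J (C : nat -> R -> Prop) :
  colength_le n J -> subsetR J (C 0%N) ->
  (forall i, (i <= l)%N -> is_ideal (C i)) ->
  (forall i, (i < l)%N -> ssubsetR (C i) (C i.+1)) -> (l <= n)%N.
Proof.
elim: n l J C => [|n IH] [|l] J C // cJ JC idC sC.
  by case: (colength_le_mono JC cJ _ (idC 1%N isT) (sC 0%N isT)).
apply: (IH l (C 1%N) (fun i => C i.+1)) => //.
- exact: (colength_le_mono JC cJ _ (idC 1%N isT) (sC 0%N isT)).
- by move=> i le_il; apply: idC.
- by move=> i lt_il; apply: sC.
Qed.

(** * Prime ideals and dimension *)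

Lemma prime_is_ideal P : prime_ideal P -> is_ideal P.
Proof. by case=> -[]. Qed.

Fixpoint prime_chain_from k Q : Prop :=
  prime_ideal Q /\
  if k is k'.+1 then exists2 Q', ssubsetR Q Q' & prime_chain_from k' Q' else True.

(** This is [dim R/J <= d], vacuously true for [J = R]. *)
Definition dim_le d J :=
  forall k Q, subsetR J Q -> prime_chain_from k Q -> (k <= d)%N.

Lemma prime_chain_from_prime k Q : prime_chain_from k Q -> prime_ideal Q.
Proof. by case: k => [|k] []. Qed.

Lemma prime_chain_from_seq k Q : prime_chain_from k Q ->
  exists P : nat -> R -> Prop, [/\ P 0%N = Q,
    forall i, (i <= k)%N -> prime_ideal (P i) &
    forall i, (i < k)%N -> ssubsetR (P i) (P i.+1)].
Proof.
elim: k Q => [|k IH] Q [prQ]; first by exists (fun=> Q).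
case=> Q' sQ /IH[P [P0 prP sP]].
exists (fun i => if i is j.+1 then P j else Q); split=> //.
- by case=> [|i] //; apply: prP.
- by case=> [|i]; [rewrite P0 | apply: sP].
Qed.

Lemma krull_dim_dim_le d J : krull_dim R d -> dim_le d J.
Proof.
case=> _ dimR k Q _ /prime_chain_from_seq[P [_ prP sP]].
apply: (dimR k (fun i => P i)); split=> i; first by apply: prP; rewrite -ltnS.
by rewrite lift0; apply: (sP i (ltn_ord i)).
Qed.

(** The product of the members of [ps] lies in [J]; iterated colons avoid forming that product. *)
Fixpoint products_in (ps : seq (R -> Prop)) J : Prop :=
  if ps is P :: ps' then forall x, P x -> products_in ps' (colon J x) else J 1.

Lemma products_in_mono ps J K : subsetR J K -> products_in ps J -> products_in ps K.
Proof.
elim: ps J K => [|P ps IH] J K sJK /=; first exact: sJK.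
by move=> psJ x Px; apply: IH (psJ x Px); apply: colon_mono.
Qed.

Lemma products_in_cat ps qs J K : products_in ps K ->
  (forall k, K k -> products_in qs (colon J k)) -> products_in (ps ++ qs) J.
Proof.
elim: ps J K => [|P ps IH] J K /= psK qsJ.
  by apply: products_in_mono (qsJ _ psK) => z; rewrite /colon mul1r.
move=> x Px; apply: IH (psK x Px) _ => k /qsJ.
by apply: products_in_mono => z; rewrite /colon mulrA.
Qed.

Lemma products_in_prime ps Q : prime_ideal Q -> products_in ps Q ->
  exists2 P, List.In P ps & subsetR P Q.
Proof.
case=> -[idQ nQ1] prQ; elim: ps => [|P ps IH] //= psQ.
case: (classic (subsetR P Q)) => [sPQ|/not_subset[x Px nQx]].
  by exists P => //; left.
case: IH => [|P' P'ps sP'Q]; last by exists P' => //; right.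
by apply: products_in_mono (psQ x Px) => z /prQ[].
Qed.

Lemma products_in_pow ps J m : is_ideal J -> products_in ps J ->
  (forall P, List.In P ps -> subsetR m P) -> subsetR (ideal_pow m (size ps)) J.
Proof.
elim: ps J => [|P ps IH] J idJ /= psJ mP; first by move=> x _; apply: ideal1.
apply: ideal_mul_min => [|x y|a b ma mb]; first exact: ideal0.
- exact: idealD.
rewrite mulrC; apply: (IH (colon J b)) => //; first exact: colon_ideal.
- by apply: psJ; apply: mP mb; left.
- by move=> Q Qps; apply: mP; right.
Qed.

(** If a maximal counterexample [M] contains [x y] but neither factor, then [(M + x)(M + y)] lies in
    [M] and the two lists concatenate. The list plays the part of the minimal primes of [J]. *)
Lemma noetherian_prime_products J : noetherian R -> is_ideal J ->
  exists ps, (forall P, List.In P ps -> prime_ideal P /\ subsetR J P) /\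
    products_in ps J.
Proof.
move=> noeR idJ0; apply: NNPP => bad0.
have [||M [idM badM] maxM] := @acc_maximal R (@is_ideal R) (fun J => is_ideal J /\
  ~ exists ps, (forall P, List.In P ps -> prime_ideal P /\ subsetR J P) /\
    products_in ps J) J noeR; [by move=> M [] | by [] |].
apply: (badM).
case: (classic (M 1)) => [M1|nM1]; first by exists [::].
case: (classic (prime_ideal M)) => [prM|nprM].
  exists [:: M]; split=> [P [<- |[]]|x Mx]; first by split.
  by rewrite /= /colon mulr1.
have [x [y [Mxy nMx nMy]]] : exists x y, [/\ M (x * y), ~ M x & ~ M y].
  apply: NNPP => no; apply: nprM; split=> // x y Mxy.
  by apply: NNPP => /not_or_and[nx ny]; apply: no; exists x, y.
have larger z : ~ M z -> exists ps,
    (forall P, List.In P ps -> prime_ideal P /\ subsetR (ideal_add M (principal z)) P) /\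
    products_in ps (ideal_add M (principal z)).
  move=> nMz; apply: NNPP => bad; apply/nMz/(maxM (ideal_add M (principal z))).
  - by split=> //; apply/ideal_add_ideal/principal_ideal.
  - exact/ideal_addl/principal_ideal.
  - exact/ideal_addr/principal_gen.
have [ps [psP psM]] := larger x nMx; have [qs [qsP qsM]] := larger y nMy.
exists (ps ++ qs); split=> [P|].
  rewrite List.in_app_iff => -[/psP|/qsP] [prP sP]; split=> // z Mz; apply: sP;
    exact: (ideal_addl (principal_ideal _)).
apply: products_in_cat psM _ => _ [u [_ [Mu [a ->] ->]]].
apply: products_in_mono qsM => _ [v [_ [Mv [b ->] ->]]]; rewrite /colon.
have -> : (u + a * x) * (v + b * y) =
  (v + b * y) * u + (a * x) * v + (a * b) * (x * y) by ring.
by apply: idealD => //; [apply: idealD => //|]; apply: idealMl.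
Qed.

Lemma prime_avoidance_step m Q ps : prime_ideal Q -> is_ideal m ->
  ~ subsetR m Q -> (forall P, List.In P ps -> prime_ideal P) ->
  exists y, [/\ m y, ~ Q y & forall P, List.In P ps -> subsetR P Q \/ P y].
Proof.
move=> [[idQ _] prQ] idm /not_subset[y0 my0 nQy0].
elim: ps => [|P ps IH] prps; first by exists y0.
have [|y [my nQy yps]] := IH; first by move=> P' P'ps; apply: prps; right.
case: (classic (subsetR P Q)) => [sPQ|/not_subset[w Pw nQw]].
  by exists y; split=> // P' [<-|/yps //]; left.
exists (w * y); split; first exact: idealMl.
  by move/prQ => [].
move=> P' [<-|P'ps].
  by right; apply: idealMr => //; apply/prime_is_ideal/prps; left.
case: (yps _ P'ps) => [|P'y]; first by left.
by right; apply: idealMl => //; apply/prime_is_ideal/prps; right.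
Qed.

Lemma prime_avoidance m ps : is_ideal m ->
  (forall P, List.In P ps -> prime_ideal P) ->
  exists2 x, m x & forall P, List.In P ps -> subsetR m P \/ ~ P x.
Proof.
move=> idm; elim: ps => [|Q ps IH] prps; first by exists 0 => //; apply: ideal0.
have prps' P : List.In P ps -> prime_ideal P by move=> Pps; apply: prps; right.
have prQ : prime_ideal Q by apply: prps; left.
have idQ := prime_is_ideal prQ.
have [x mx xps] := IH prps'.
case: (classic (subsetR m Q)) => [smQ|nmQ].
  by exists x => // P [<-|/xps //]; left.
case: (classic (Q x)) => [Qx|nQx]; last by exists x => // P [<-|/xps //]; right.
(* [x + y] leaves [Q], hence every prime inside [Q]; the other primes contain [y], so for them
   [x + y] is as good as [x]. *)
have [y [my nQy yps]] := prime_avoidance_step prQ idm nmQ prps'.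
have nQxy : ~ Q (x + y).
  by move=> Qxy; apply: nQy; rewrite -[y](addKr x) addrC; apply: idealB.
exists (x + y); first exact: idealD.
move=> P [<-|Pps]; first by right.
case: (xps _ Pps) => [|nPx]; first by left.
right=> Pxy; case: (yps _ Pps) => [sPQ|Py]; first exact/nQxy/sPQ.
apply: nPx; rewrite -[x](addrK y); apply: idealB => //.
exact/prime_is_ideal/prps'.
Qed.

(** * Local rings and the Hilbert-Samuel bound *)

Section Local.
Variable m : R -> Prop.
Hypotheses (noeR : noetherian R) (locR : local_ring_with m).

Let idm : is_ideal m. Proof. by case: locR => -[]. Qed.

Lemma local_max J : is_ideal J -> ~ J 1 -> subsetR J m.
Proof. by case: locR => _ + idJ nJ1; apply. Qed.

Lemma local_prime : prime_ideal m.
Proof.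
case: (locR) => prm _; split=> // x y mxy; apply: NNPP => /not_or_and[nmx nmy].
have idA := ideal_add_ideal idm (principal_ideal x).
have [z [_ [mz [a ->] oneE]]] : ideal_add m (principal x) 1.
  apply: NNPP => n1; apply/nmx/(local_max idA n1).
  exact/ideal_addr/principal_gen.
apply: nmy; rewrite -[y]mul1r oneE mulrDl -mulrA.
by apply: idealD => //; [apply: idealMr | apply: idealMl].
Qed.

Lemma colength_le_local J : subsetR m J -> colength_le 1 J.
Proof.
move=> smJ; apply: (colength_le_mono smJ) => L idL [_ [x [Lx nmx]]] /=.
move=> L' idL' [sL [z [_ nLz]]]; apply: nLz.
apply: ideal1 => //; apply: NNPP => nL1; exact/nmx/(local_max idL nL1).
Qed.

Lemma colength_le_primary J k : is_ideal J -> subsetR (ideal_pow m k) J ->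
  exists n, colength_le n J.
Proof.
move=> idJ; have [s [sm mgen]] := noetherian_fg noeR idm.
(* Generation of [m] modulo [J] is the invariant that survives moving [f] from the list into [J];
   since [f^k] lies in [J], this move costs a factor [k]. *)
have {mgen} : forall K, is_ideal K -> subsetR J K -> (forall f, f \in s -> K f) ->
  subsetR m K by move=> K idK _; apply: mgen.
elim: s J idJ sm => [|f s IH] J idJ sm mgen mkJ.
  by exists 1%N; apply: colength_le_local; apply: mgen.
have mf : m f by apply: sm; rewrite mem_head.
have sJ : subsetR J (ideal_add J (principal f)) by apply/ideal_addl/principal_ideal.
have [||K idK sJK sK|x /mkJ /sJ //|n cn] := IH (ideal_add J (principal f)).
- exact/ideal_add_ideal/principal_ideal.
- by move=> g gs; apply: sm; rewrite inE gs orbT.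
- apply: mgen => // [x /sJ /sJK //|g]; rewrite inE => /orP[/eqP->|/sK //].
  exact/sJK/ideal_addr/principal_gen.
exists (k * n)%N; apply: colength_le_expr cn => //.
exact/mkJ/ideal_powX.
Qed.

(* The Hilbert-Samuel bound [l(R/(J + m^N)) = O(N^d)]. An element [x] of [m] that
   avoids the minimal primes of [J] makes the dimension drop, and [x^N] lies in
   [m^N], so that dividing by [x] costs at most a factor [N]. *)
Lemma colength_le_samuel d J : is_ideal J -> dim_le d J ->
  exists l, forall N, colength_le (l * N ^ d) (ideal_add J (ideal_pow m N)).
Proof.
elim: d J => [|d IH] J idJ dimJ;
  have [ps [psP psJ]] := noetherian_prime_products noeR idJ.
  (* In dimension zero a listed prime cannot lie strictly below [m], so a power of [m] lies in
     [J]. *)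
  have mps P : List.In P ps -> subsetR m P.
    move=> /psP[prP sJP]; apply: NNPP => nmP.
    suff : (1 <= 0)%N by [].
    apply: (dimJ 1%N P sJP); split=> //; exists m; last by split=> //; apply: local_prime.
    split; last by have [x mx nPx] := not_subset nmP; exists x.
    by apply: local_max; [apply: prime_is_ideal | case: prP => -[]].
  have [l cl] := colength_le_primary idJ (products_in_pow idJ psJ mps).
  exists l => N; rewrite expn0 muln1; apply: colength_le_mono cl.
  exact/ideal_addl/ideal_pow_ideal.
have [x mx xps] := prime_avoidance idm (fun P Pps => (psP P Pps).1).
have idJx := ideal_add_ideal idJ (principal_ideal x).
have [|l cl] := IH _ idJx.
  move=> k Q sQ chQ; have prQ := prime_chain_from_prime chQ.
  have sJQ : subsetR J Q by move=> z Jz; apply/sQ/ideal_addl/Jz/principal_ideal.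
  have Qx : Q x by apply/sQ/ideal_addr/principal_gen.
  (* Either [P] contains [m], and the chain from [Q] has length zero, or [P] misses [x], and
     prepending [P] lengthens the chain by one. *)
  have [P Pps sPQ] := products_in_prime prQ (products_in_mono sJQ psJ).
  have [prP sJP] := psP P Pps.
  case: (xps _ Pps) => [smP|nPx].
    case: k chQ => // k [_ [Q' [_ [z [Q'z nQz]]] /prime_chain_from_prime prQ']].
    case: nQz; apply/sPQ/smP/(local_max (prime_is_ideal prQ')) => //.
    by case: prQ' => -[].
  rewrite -ltnS; apply: (dimJ k.+1 P sJP); split=> //; exists Q => //.
  by split=> //; exists x.
exists l => N; have idmN := ideal_pow_ideal N idm.
rewrite expnS mulnCA; apply: (@colength_le_expr _ x).
- exact: ideal_add_ideal.
- by apply: ideal_addr => //; apply: ideal_powX.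
apply: colength_le_mono (cl N) => _ [_ [v [[u [w [Ju xw ->]]] mv ->]]].
exists (u + v), w; split=> //; last by ring.
by exists u, v.
Qed.

End Local.

(** * Rees algebras and the Artin-Rees bound *)

Section Rees.
Variables (s : nat) (A : 'I_s -> R -> Prop).
Hypotheses (noeR : noetherian R) (idA : forall i, is_ideal (A i)).

(** The multigraded Rees algebra of the ideals [A i], as a subring of the polynomial ring. *)
Definition rees_coef (p : {mpoly R[s]}) :=
  forall al : 'X_{1..s}, ideal_prod_pow A al p@_al.

Definition constants (p : {mpoly R[s]}) := exists c, p = c%:MP.

Lemma rees_coef_subring : subring rees_coef.
Proof.
have J0 al : ideal_prod_pow A al 0 by case: (ideal_prod_pow_ideal idA al).
have G1 : rees_coef 1.
  move=> al; rewrite mcoeff1; case: eqP => [->|_] //=.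
  by apply: ideal_prod_pow0 => i; rewrite mnm0E.
have idJ (al : 'X_{1..s}) : is_ideal (ideal_prod_pow A al).
  exact: ideal_prod_pow_ideal.
split=> // [al|p q Gp Gq al|p q Gp Gq al].
- by rewrite mcoeffN -mulN1r; apply: idealMl.
- by rewrite mcoeffD; apply: idealD.
rewrite mcoeffM; apply: big_ind => // [x y|k /eqP alE]; first exact: idealD.
by have := ideal_prod_powM idA (Gp k.1) (Gq k.2); rewrite -alE.
Qed.

Lemma constants_subring : subring constants.
Proof.
split; first by exists 1.
- by exists (-1); rewrite mpolyCN.
- by move=> _ _ [a ->] [b ->]; exists (a + b); rewrite mpolyCD.
- by move=> _ _ [a ->] [b ->]; exists (a * b); rewrite mpolyCM.
Qed.

Lemma constants_acc : acc (ideal_of constants).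
Proof.
move=> K idK upK.
have [k|k x|N stN] := noeR (I := fun k c => K k c%:MP).
- case: (idK k) => _ K0 KD KM; split=> [|x y Kx Ky|a x Kx].
  + by rewrite mpolyC0.
  + by rewrite mpolyCD; apply: KD.
  + by rewrite mpolyCM; apply: KM => //; exists a.
- exact: upK.
exists N => k le_Nk x Kx; have [c xE] : constants x by case: (idK k) => + _ _ _; apply.
by rewrite xE in Kx *; apply: stN Kx.
Qed.

(** Finitely many [a X_i], with [a] among generators of [A i], are adjoined to the constants, so the
    basis theorem applies at each step. *)
Lemma rees_subring : exists S : {mpoly R[s]} -> Prop,
  [/\ subring S, acc (ideal_of S), forall c, S c%:MP,
    forall p, S p -> rees_coef p & forall i a, A i a -> S (a%:MP * 'X_i)].
Proof.
suff main (l : seq 'I_s) : exists S : {mpoly R[s]} -> Prop,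
    [/\ subring S, acc (ideal_of S), forall c, S c%:MP,
    forall p, S p -> rees_coef p & forall i a, i \in l -> A i a -> S (a%:MP * 'X_i)].
  have [S [rS aS cS SG gS]] := main (enum 'I_s).
  by exists S; split=> // i a; apply: gS; rewrite mem_enum.
have idJ := ideal_prod_pow_ideal idA.
elim: l => [|i l [S [rS aS cS SG gS]]].
  exists constants; split=> // [|||_ [c ->] al].
  - exact: constants_subring.
  - exact: constants_acc.
  - by move=> c; exists c.
  rewrite mcoeffC; apply: idealMl => //.
  by have [+ _ _ _] := rees_coef_subring => /(_ al); rewrite mcoeff1.
have [f [fA fgen]] := noetherian_fg noeR (idA i).
have [x|S' [rS' aS' SS' S'G fS']] := adjoin_seq
    (s := [seq a%:MP * 'X_i | a <- f]) rS aS rees_coef_subring SG.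
  case/mapP => a /fA Aa -> al; rewrite mcoeffCM mcoeffX.
  case: eqP => [<-|_]; first by rewrite mulr1; apply: ideal_prod_pow_gen.
  by rewrite mulr0; apply: ideal0.
exists S'; split=> //.
  by move=> c; apply/SS'/cS.
have [S'1 _ S'D S'M] := rS'.
move=> j a; rewrite inE => /orP[/eqP -> Aa|jl Aa]; last by apply/SS'/gS.
(* The [a] with [a X_i] in [S'] form an ideal, so generators of [A i] suffice. *)
apply: (fgen (fun a => S' (a%:MP * 'X_i))) Aa => [|g gf].
  split=> [|x y Sx Sy|b x Sx].
  - by rewrite mpolyC0 mul0r; apply: subring0.
  - by rewrite mpolyCD mulrDl; apply: S'D.
  - by rewrite mpolyCM -mulrA; apply: S'M => //; apply/SS'/cS.
by apply: fS'; apply: map_f.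
Qed.

(** The nested products defining the ideal are followed in parallel with the factorisation of
    [X^al]. *)
Lemma rees_monomial (S : {mpoly R[s]} -> Prop) (al : 'X_{1..s}) x : subring S ->
  (forall c, S c%:MP) -> (forall i a, A i a -> S (a%:MP * 'X_i)) ->
  ideal_prod_pow A al x -> S (x%:MP * 'X_[al]).
Proof.
move=> rS cS gS; have [S1 _ SD SM] := rS; have S0 := subring0 rS.
have mulS K K' (p q : {mpoly R[s]}) : (forall x, K x -> S (x%:MP * p)) ->
    (forall x, K' x -> S (x%:MP * q)) ->
    forall x, ideal_mul K K' x -> S (x%:MP * (p * q)).
  move=> Kp Kq; apply: ideal_mul_min => [|y z Sy Sz|a b Ka Kb].
  - by rewrite mpolyC0 mul0r.
  - by rewrite mpolyCD mulrDl; apply: SD.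
  - by rewrite mpolyCM mulrACA; apply: SM; [apply: Kp | apply: Kq].
rewrite mpolyXE_id; move: x.
apply: (big_ind2 (fun K p => forall x, K x -> S (x%:MP * p))).
- by move=> x _; rewrite mulr1.
- by move=> K p K' q; apply: mulS.
move=> i _; elim: (al i) => [|k IH] x; first by rewrite mulr1.
by rewrite exprSr; apply: mulS => // a; apply: gS.
Qed.

(* A chain of graded submodules of the Rees algebra, given degree by degree. *)
Lemma rees_acc (K : nat -> 'X_{1..s} -> R -> Prop) :
  (forall k al, is_ideal (K k al)) ->
  (forall k al, subsetR (K k al) (ideal_prod_pow A al)) ->
  (forall k (al be : 'X_{1..s}) x y, ideal_prod_pow A al x -> K k be y ->
    K k (al + be)%MM (x * y)) ->
  (forall k al, subsetR (K k al) (K k.+1 al)) ->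
  exists N, forall k al, subsetR (K k al) (K N al).
Proof.
move=> idK KJ KM upK; have [S [rS aS cS SG gS]] := rees_subring.
have [S1 _ SD SM] := rS.
(* The homogeneous ideal of [S] with components [K k al]; its stability is read back on the
   monomials [x X^al]. *)
pose H k p := S p /\ forall al, K k al p@_al.
have [k|k p [Sp Kp]|N stN] := aS H.
- split=> [p []||p q [Sp Kp] [Sq Kq]|p q Sp [Sq Kq]] //.
  + by split=> [|al]; [apply: subring0 | rewrite mcoeff0; apply: ideal0].
  + by split=> [|al]; [apply: SD | rewrite mcoeffD; apply: idealD].
  split=> [|al]; first exact: SM.
  rewrite mcoeffM; apply: big_ind => [|x y|be /eqP alE].
  + exact: ideal0.
  + exact: idealD.
  + by have := KM _ _ _ _ _ (SG _ Sp be.1) (Kq be.2); rewrite -alE.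
- by split=> // al; apply: upK.
exists N => k al x Kx; wlog le_Nk : k Kx / (N <= k)%N.
  case: (leqP N k) => [le_Nk IH|/ltnW le_kN _]; first exact: IH Kx le_Nk.
  exact: (chain_mono (fun k => upK k al) le_kN).
have [_ /(_ al)] : H N (x%:MP * 'X_[al]).
  apply: stN le_Nk _ _; split; first by apply: rees_monomial => //; apply: KJ Kx.
  move=> be; rewrite mcoeffCM mcoeffX; case: eqP => [<-|_]; first by rewrite mulr1.
  by rewrite mulr0; apply: ideal0.
by rewrite mcoeffCM mcoeffX eqxx mulr1.
Qed.

End Rees.

(** * A uniform Artin-Rees bound for saturations *)

Section Saturation.
Variables (r : nat) (I : 'I_r -> R -> Prop) (m : R -> Prop).
Hypotheses (noeR : noetherian R) (idI : forall i, is_ideal (I i)) (idm : is_ideal m).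

(** Index [ord0] carries [m] and the others the [I i], so a multidegree [al] is a pair [(k, n)] with
    [k = al ord0] and [n = tl al]. *)
Let A (j : 'I_r.+1) : R -> Prop := oapp I m (unlift ord0 j).
Let tl (al : 'X_{1..r.+1}) : 'X_{1..r} := [multinom al (lift ord0 i) | i < r].

Let rees_prod (al : 'X_{1..r.+1}) :
  ideal_prod_pow A al = ideal_mul (ideal_pow m (al ord0)) (ideal_prod_pow I (tl al)).
Proof.
rewrite /ideal_prod_pow big_ord_recl {1}/A unlift_none /=; congr ideal_mul.
by apply: eq_bigr => i _; rewrite /A liftK mnmE.
Qed.

Let idJ (n : 'X_{1..r}) : is_ideal (ideal_prod_pow I n).
Proof. exact: ideal_prod_pow_ideal. Qed.

Let mJ k (n : 'X_{1..r}) := ideal_mul (ideal_pow m k) (ideal_prod_pow I n).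

Let mJ_ideal k n : is_ideal (mJ k n).
Proof. exact/ideal_mul_ideal/ideal_pow_ideal. Qed.

Let mJ_pow k n a x : m a -> mJ k n x -> mJ k.+1 n (a * x).
Proof.
move=> ma; move: x; apply: ideal_mul_min => [|x y|b c mb Jc].
- by rewrite mulr0; apply: ideal0.
- by rewrite mulrDr; apply: idealD.
by rewrite mulrA [a * b]mulrC; apply: ideal_mul_in => //; apply: ideal_mul_in.
Qed.

Let mJ_prod k (n n' : 'X_{1..r}) a x :
  ideal_prod_pow I n' a -> mJ k n x -> mJ k (n' + n)%MM (a * x).
Proof.
move=> Ja; move: x; apply: ideal_mul_min => [|x y|b c mb Jc].
- by rewrite mulr0; apply: ideal0.
- by rewrite mulrDr; apply: idealD.
by rewrite mulrCA; apply: ideal_mul_in => //; apply: ideal_prod_powM.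
Qed.

Let mJ_powS k n : subsetR (mJ k.+1 n) (mJ k n).
Proof. by apply: ideal_mul_mono => //; apply: ideal_powS. Qed.

(* In degree [(k, n)] the [l]-th member of the chain consists of the [x] in [m^k J_n]
   with [m^u x <= m^v J_(n + e_i)] whenever [u - v = l - k]; writing this with additions
   only makes stability under the Rees algebra immediate. *)
Lemma artin_rees_saturation i : exists c, forall k (n : 'X_{1..r}) x, (c <= k)%N ->
  ideal_mul (ideal_pow m k) (ideal_prod_pow I n) x ->
  saturation (ideal_prod_pow I (n + U_(i))%MM) m x ->
  ideal_mul (ideal_pow m (k - c)) (ideal_prod_pow I (n + U_(i))%MM) x.
Proof.
have idA j : is_ideal (A j) by rewrite /A; case: unlift.
pose K l (al : 'X_{1..r.+1}) x := ideal_prod_pow A al x /\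
  forall u v z, (u + al ord0 = l + v)%N -> ideal_pow m u z ->
    mJ v (tl al + U_(i))%MM (z * x).
have [||||c cP] := @rees_acc _ A noeR idA K.
- move=> l al; split=> [|x y [Jx Kx] [Jy Ky]|a x [Jx Kx]].
  + split; first by apply: ideal0; apply: ideal_prod_pow_ideal.
    by move=> u v z _ _; rewrite mulr0; apply: ideal0.
  + split; first by apply: idealD => //; apply: ideal_prod_pow_ideal.
    move=> u v z uv mz; rewrite mulrDr; apply: idealD => //;
      [exact: Kx mz | exact: Ky mz].
  + split; first by apply: idealMl => //; apply: ideal_prod_pow_ideal.
    by move=> u v z uv mz; rewrite mulrCA; apply: idealMl => //; apply: Kx mz.
- by move=> l al x [].
- move=> l al be x y Jx [Jy Ky]; split; first exact: ideal_prod_powM.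
  move=> u v z; rewrite mnmDE addnA => uv mz.
  have -> : (tl (al + be) + U_(i) = tl al + (tl be + U_(i)))%MM.
    by apply/mnmP => j; rewrite !mnmE addnA.
  move: x Jx; rewrite rees_prod; apply: ideal_mul_min => [|x x'|a b ma Jb].
  + by rewrite mul0r mulr0; apply: ideal0.
  + by rewrite mulrDl mulrDr; apply: idealD.
  have -> : z * (a * b * y) = b * (z * a * y) by ring.
  by apply: mJ_prod => //; apply: Ky uv _; apply: ideal_powM.
- move=> l al x [Jx Kx]; split=> // u v z; rewrite addSnnS => uv mz.
  exact/mJ_powS/(Kx _ _ _ uv mz).
exists c => k n x le_ck mJx [t satx].
pose al : 'X_{1..r.+1} := [multinom oapp n k (unlift ord0 j) | j < r.+1].
have al0 : al ord0 = k by rewrite mnmE unlift_none.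
have tlal : tl al = n by apply/mnmP => j; rewrite !mnmE liftK.
(* With [m^t x] inside [J_(n + e_i)], [x] lies in stage [t + k], where the condition reads
   [u = t + v]. Stability puts it in stage [c], which is used at [u = 0], [v = k - c], [z = 1]. *)
have [_ /(_ 0 (k - c)%N 1)] : K c al x.
  apply: (cP (t + k)%N); split; first by rewrite rees_prod al0 tlal.
  rewrite al0 tlal => u v z /eqP; rewrite addnAC eqn_add2r => /eqP ->.
  elim: v z => [|v IH] z.
    rewrite addn0 => /satx Jzx; rewrite -[z * x]mul1r; exact: ideal_mul_in.
  rewrite addnS; move: z; apply: ideal_mul_min => [|y z|a b ma mb].
  - by rewrite mul0r; apply: ideal0.
  - by rewrite mulrDl; apply: idealD.
  by rewrite mulrAC mulrC; apply/mJ_pow/IH.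
by rewrite al0 tlal mul1r add0n subnKC //; apply.
Qed.

(** Keeping the factor [m^(N - c |n|)] for arbitrary [N] lets the induction continue: each unit of
    [|n|] costs [c] powers of [m]. *)
Lemma saturation_pow : exists c, forall (n : 'X_{1..r}) N x, (c * mdeg n <= N)%N ->
  ideal_pow m N x -> saturation (ideal_prod_pow I n) m x ->
  ideal_mul (ideal_pow m (N - c * mdeg n)) (ideal_prod_pow I n) x.
Proof.
have [c cP] := fin_all_exists artin_rees_saturation.
exists (\max_i c i) => n N x; set C := \max_i c i.
move: {2}(mdeg n) (erefl (mdeg n)) => k; elim: k n => [|k IH] n degn.
  move=> _ mx _; rewrite degn muln0 subn0 -[x]mulr1; apply: ideal_mul_in => //.
  apply: ideal_prod_pow0 => i.
  by move/eqP: degn; rewrite mdeg_eq0 => /eqP ->; rewrite mnm0E.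
have [i ni] : exists i, n i != 0%N.
  apply/existsP; apply: contra_eqT degn => /existsPn n0.
  rewrite mdegE big1 // => i _; apply/eqP; move: (n0 i); by rewrite negbK.
have nE : n = (n - U_(i) + U_(i))%MM by rewrite submK // lep1mP.
set n' := (n - U_(i))%MM in nE.
have degn' : mdeg n' = k.
  by apply/eqP; rewrite -eqSS -degn nE mdegD mdeg1 addn1.
rewrite degn nE mulnS => leN mx sx.
have le_cC : (c i <= C)%N by apply: leq_bigmax.
have leN' : (C * k <= N)%N by apply: leq_trans leN; apply: leq_addl.
have leC : (C <= N - C * k)%N by rewrite leq_subRL // addnC.
have := IH n' degn'; rewrite degn' => /(_ leN' mx) IHx.
(* [J_n] lies in [J_n'], so the saturation hypothesis passes to [n']. *)
have : mJ (N - C * k) n' x.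
  apply: IHx; case: sx => t sx; exists t => y /sx.
  exact: ideal_prod_powDr.
move/(cP i _ _ _ (leq_trans le_cC leC))/(_ sx).
apply: ideal_mul_mono => //; apply: ideal_pow_le => //.
by rewrite addnC subnDA; apply: leq_sub2l.
Qed.

End Saturation.

(** * Comparison of local cohomology with [R/m^N] *)

Lemma length_H0_le_colength m J N n : is_ideal m -> is_ideal J ->
  (forall x, ideal_pow m N x -> saturation J m x -> J x) ->
  colength_le n (ideal_pow m N) -> length_H0_le m J n%:R.
Proof.
move=> idm idJ satJ cn l C [idC JC Csat sC]; rewrite ler_nat.
have idmN := ideal_pow_ideal N idm.
(* The chain [C] reindexed by all naturals, constant from [l] on. *)
pose E k := C (inord (minn k l)).
have idE k : is_ideal (E k) by apply: idC.
have E_step k : (k < l)%N -> ssubsetR (E k) (E k.+1).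
  move=> lt_kl; have := sC (Ordinal lt_kl).
  congr (ssubsetR (C _) (C _)); apply: val_inj; rewrite /= ?lift0 inordK //;
    by rewrite ?ltnS ?geq_minr // (minn_idPl _) // ltnW.
have upE k x : E k x -> E k.+1 x.
  case: (ltnP k l) => [/E_step[+ _]|le_lk]; first by apply.
  by rewrite /E !(minn_idPr _) // ltnW.
have El k x : E k x -> saturation J m x.
  move=> Ek; apply: Csat; have -> : C ord_max = E (maxn k l).
    congr C; apply: val_inj; rewrite /= inordK ?ltnS ?geq_minr //.
    by rewrite (minn_idPr _) // leq_maxr.
  exact: (chain_mono upE (leq_maxl k l)) Ek.
have E0 k x : J x -> E k x.
  move=> /JC C0; apply: (chain_mono upE (leq0n k)).
  suff -> : E 0%N = C ord0 by [].
  by congr C; apply: val_inj; rewrite /= min0n inordK.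
apply: (colength_le_chain (C := fun k => ideal_add (E k) (ideal_pow m N)) cn).
- by apply: ideal_addr.
- by move=> i _; apply: ideal_add_ideal.
move=> i /E_step[sE [x [Ex nEx]]]; split; first exact: ideal_add_mono.
exists x; split; first exact: ideal_addl.
(* Adding [m^N] keeps the chain strict: [v = x - u] lies in the saturation and in [m^N], hence in
   [J], which is below [E i]. *)
move=> [u [v [Eu mv xE]]]; apply: nEx; rewrite xE; apply: idealD => //.
apply/E0/satJ => //; apply: (El i.+1).
have -> : v = x - u by rewrite xE; ring.
by apply: idealB => //; apply: sE.
Qed.

End Ideals.

Theorem theorem5p1 (R : comNzRingType) (m : R -> Prop) (d r : nat)
  (I : 'I_r -> R -> Prop) :
  noetherian R -> local_ring_with m -> krull_dim R d ->
  (forall i, is_ideal (I i)) ->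
  exists F : {mpoly rat[r]},
    [/\ numerical_poly F, (msize F <= d.+1)%N &
      exists N : nat, forall n : 'I_r -> nat, (forall i, (N <= n i)%N) ->
        length_H0_le m (ideal_prod_pow I n) (F.@[fun i => (n i)%:R])].
Proof.
move=> noeR locR dimR idI; have idm : is_ideal m by case: locR => -[].
have [c cP] := saturation_pow noeR idI idm.
(* The Hilbert-Samuel bound is taken at the zero ideal, where it concerns [R/m^N] itself. *)
have id0 := principal_ideal (0 : R).
have [l lP] := colength_le_samuel noeR locR id0 (krull_dim_dim_le dimR).
pose F : {mpoly rat[r]} := (l * c ^ d)%:R *: (\sum_i 'X_i) ^+ d.
have evalF v : F.@[v] = (l * c ^ d)%:R * (\sum_i v i) ^+ d.
  rewrite /F mevalZ rmorphXn raddf_sum; congr (_ * _ ^+ _).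
  by apply: eq_bigr => i _; apply: mevalXU.
exists F; split.
- move=> z; exists ((l * c ^ d)%N%:Z * (\sum_i z i) ^+ d).
  by rewrite evalF intrM rmorphXn /= raddf_sum.
- have /dhomogP homF : F \is d.-homog.
    rewrite -[d in d.-homog]mul1n; apply: dhomogZ; apply: dhomogMn.
    by apply: rpred_sum => i _; rewrite dhomogX /= mdeg1.
  by rewrite msizeE; apply/bigmax_leqP_seq => be /homF ->.
(* The bound holds for every [n], so the threshold is zero. *)
exists 0%N => n _; pose al : 'X_{1..r} := [multinom n i | i < r].
have idJ := ideal_prod_pow_ideal idI n.
rewrite evalF -natr_sum -natrX -natrM.
have -> : (\sum_i n i)%N = mdeg al by rewrite mdegE; apply: eq_bigr => i _; rewrite mnmE.
rewrite -mulnA -expnMn.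
have JE : ideal_prod_pow I al = ideal_prod_pow I n.
  by apply: eq_ideal_prod_pow => i; rewrite mnmE.
apply: (length_H0_le_colength (N := (c * mdeg al)%N)) => //.
- move=> x mx; rewrite -JE => sx; have := cP _ _ _ (leqnn _) mx sx.
  apply: ideal_mul_min => [|y z|a b _]; rewrite ?JE.
  + exact: ideal0.
  + exact: idealD.
  + exact: idealMl.
apply: colength_le_mono (lP (c * mdeg al)%N) => _ [_ [v [[a ->] mv ->]]].
by rewrite mulr0 add0r.
Qed.
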